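(* Let $R$ be a von Neumann regular ring which is right CS (equivalently, for a regular ring, right continuous, or right quasi-continuous). Then $R$ is separative.
   Context: Rings are associative with identity. A ring $R$ is (von Neumann) regular if for every $a\in R$ there exists $b\in R$ with $a=aba$. A right module $M$ is CS if every submodule of $M$ is essential in a direct summand of $M$. A CS module $M$ is continuous if moreover every submodule of $M$ isomorphic to a direct summand of $M$ is itself a direct summand, and quasi-continuous if moreover, for direct summands $A,B$ of $M$ with $A\cap B=0$, $A\oplus B$ is a direct summand of $M$. A ring $R$ is right CS (continuous, quasi-continuous) if the right module $R_R$ is; for regular rings the three notions are equivalent. A ring $R$ is separative if for any finitely generated projective right $R$-modules $M$ and $N$, the isomorphisms $M\oplus N\cong M\oplus M\cong N\oplus N$ imply $M\cong N$. *)

(* Defs.v *)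
From HB Require Import structures.
From mathcomp Require Import all_boot all_order all_algebra.
From mathcomp Require Import boolp classical_sets.

Set Implicit Arguments.
Unset Strict Implicit.
Unset Printing Implicit Defensive.

Import GRing.Theory.

Local Open Scope classical_set_scope.
Local Open Scope ring_scope.

(* A right R-module is an [lmodType] over the converse ring [R^c], in which
   [a *: x] stands for the right action [x . a].  The notions below are stated
   for an [lmodType S] and used with [S := R^c]. *)

Section Modules.
Variable S : pzRingType.
Implicit Types M N : lmodType S.

Definition submodule M (A : set M) : Prop := submod_closed [in A].

Definition essential_in M (A B : set M) : Prop :=
  A `<=` B /\
  forall C : set M, submodule C -> C `<=` B ->
    A `&` C = [set 0] -> C = [set 0].

Definition direct_summand M (A : set M) : Prop :=
  submodule A /\
  exists B : set M,
    [/\ submodule B, A `&` B = [set 0]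
      & forall x : M, exists2 a, A a & exists2 b, B b & x = a + b].

Definition CS_module M : Prop :=
  forall A : set M, submodule A ->
    exists2 B : set M, direct_summand B & essential_in A B.

Definition finitely_generated M : Prop :=
  exists (n : nat) (v : 'I_n -> M), forall x : M,
    exists c : 'I_n -> S, x = \sum_(i < n) c i *: v i.

Definition projective M : Prop :=
  forall (A B : lmodType S) (g : {linear A -> B}) (f : {linear M -> B}),
    (forall b : B, exists a : A, g a = b) ->
    exists h : {linear M -> A}, forall x : M, g (h x) = f x.

Definition isomorphic M N : Prop :=
  exists f : {linear M -> N}, bijective f.

End Modules.

Definition regular_ring (R : pzRingType) : Prop :=
  forall a : R, exists b : R, a = a * b * a.

(* [(R^c)^o] is R_R: there [a *: x] is [x * a], computed in R. *)
Definition right_CS (R : pzRingType) : Prop :=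
  CS_module ((R^c)^o : lmodType R^c).

(* The product [M * N] carries the direct sum of [M] and [N]. *)
Definition separative (R : pzRingType) : Prop :=
  forall M N : lmodType R^c,
    finitely_generated M -> projective M ->
    finitely_generated N -> projective N ->
    isomorphic (M * N)%type (M * M)%type ->
    isomorphic (M * M)%type (N * N)%type ->
    isomorphic M N.

(* Main.v *)
Require Import Defs.
From mathcomp Require Import all_boot all_order all_algebra.
From HB Require Import structures.
From mathcomp Require Import boolp classical_sets generic_quotient.

(* Let V be the monoid of isomorphism classes of finitely generated projective
   modules.  Regularity gives V refinement and makes every class a finite sum of
   classes below u = [S], so separativity reduces to cancelling one class c <= u
   from a + c = b + c when c <= a and c <= b.  Refining, a = a1 + y, b = a1 + x and
   c = x + z = y + z.  The CS hypothesis and Zorn's lemma yield general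
   comparability: after removing a common summand, x and y are separated by a
   central idempotent g.  Cutting x + z = y + z by g and by 1 - g shows that z
   absorbs both x and y; hence c, and with it a and b, absorbs both, so that
   a = a + x = b + y = b. *)

Set Implicit Arguments.
Unset Strict Implicit.
Unset Printing Implicit Defensive.

Import GRing.Theory.

Local Open Scope ring_scope.

(** * Orthogonal idempotents and refinement of two decompositions *)

Definition orth_idem (T : pzRingType) (e f : T) : Prop :=
  [/\ e * e = e, f * f = f, e * f = 0 & f * e = 0].

Section Idempotents.
Variable T : pzRingType.
Implicit Types e f s t x y : T.

Lemma orth_idemD e f : orth_idem e f -> (e + f) * (e + f) = e + f.
Proof. by case=> ee ff ef fe; rewrite mulrDl !mulrDr ee ff ef fe addr0 add0r. Qed.

Lemma orth_idem_sub e x : e * e = e -> x * x = x -> x * e = x -> e * x = x ->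
  orth_idem x (e - x).
Proof.
move=> ee xx xe ex; split=> //.
- by rewrite mulrBl !mulrBr ee ex xe xx subrr subr0.
- by rewrite mulrBr xe xx subrr.
- by rewrite mulrBl ex xx subrr.
Qed.

(** [s0 * t * s0] is a reflexive inverse of [t]; multiplying it by [e] and [f] confines it to a
    corner and keeps this property. *)
Lemma regular_inner e f t s0 : e * e = e -> f * f = f -> f * t = t -> t * e = t ->
  t * s0 * t = t ->
  exists s, [/\ t * s * t = t, s * t * s = s, e * s = s & s * f = s].
Proof.
move=> ee ff ft te tst; exists (e * s0 * t * s0 * f); split.
- by rewrite !mulrA te tst -mulrA ft tst.
- have -> : e * s0 * t * s0 * f * t * (e * s0 * t * s0 * f) =
    e * s0 * (t * s0 * (f * t) * e * s0 * t) * s0 * f by rewrite !mulrA.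
  by rewrite ft tst te tst.
- by rewrite !mulrA ee.
- by rewrite -!mulrA ff.
Qed.

(* With [s] a reflexive inverse of [f * e], the idempotent [f * e * s] is the
   part of [f] matched with [e], and [f' * e] restricted to the kernel of
   [f * e] supplies the part of [f'] matched with [e]. *)
Lemma orth_idem_refinement e e' f f' s0 :
  f * e * s0 * (f * e) = f * e ->
  orth_idem e e' -> orth_idem f f' -> e + e' = f + f' ->
  exists f1 f2 f3 f4,
    [/\ orth_idem f1 f2 /\ orth_idem f3 f4, orth_idem f1 f3 /\ orth_idem f2 f4,
       f = f1 + f2 /\ f' = f3 + f4,
       exists a b, a * b = e /\ b * a = f1 + f3
     & exists a b, a * b = e' /\ b * a = f2 + f4].
Proof.
move=> reg [ee e'e' ee' e'e] [ff f'f' ff' f'f] eqp.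
have [||s [tst sts es sf]] := regular_inner ee ff _ _ reg.
- by rewrite mulrA ff.
- by rewrite -mulrA ee.
set t := f * e in tst sts.
have ft : f * t = t by rewrite mulrA ff.
have te : t * e = t by rewrite -mulrA ee.
have ss : s * s = s.
  have <- : s * f * (e * s) = s * s by rewrite sf es.
  by rewrite -mulrA (mulrA f) mulrA.
have f't : f' * t = 0 by rewrite mulrA f'f mul0r.
(* With images read as right ideals, [e2] projects onto the kernel of [t] in the image of [e]. As
   [f * e2 = 0], this kernel lies in the image of [f'], and [f3] is an idempotent below [f'] with
   the same image. *)
pose e2 := e - s * t; pose f1 := t * s; pose f3 := e2 * f'.
have ee2 : e * e2 = e2 by rewrite mulrBr ee mulrA es.
have fe2 : f * e2 = 0.
  by rewrite mulrBr -/t mulrA -[in f * s]es mulrA -/t tst subrr.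
have f'e2 : f' * e2 = e2.
  have pe2 : (e + e') * e2 = e2 by rewrite mulrDl -{2}ee2 mulrA e'e mul0r addr0.
  by rewrite -[RHS]pe2 eqp mulrDl fe2 add0r.
have e2e2 : e2 * e2 = e2.
  by rewrite [LHS]mulrBl ee2 -mulrA -[e2 in t * e2]ee2 mulrA te
             [t * e2]mulrBr te mulrA tst subrr mulr0 subr0.
have te2 : t * e2 = 0 by rewrite mulrBr te mulrA tst subrr.
have e2s : e2 * s = 0 by rewrite mulrBl es sts subrr.
have f1f1 : f1 * f1 = f1 by rewrite /f1 mulrA tst.
have ff1 : f * f1 = f1 by rewrite mulrA ft.
have f1f : f1 * f = f1 by rewrite -mulrA sf.
have f3f3 : f3 * f3 = f3 by rewrite /f3 mulrA -(mulrA e2) f'e2 e2e2.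
have f'f3 : f' * f3 = f3 by rewrite mulrA f'e2.
have f3f' : f3 * f' = f3 by rewrite -mulrA f'f'.
have f3e2 : f3 * e2 = e2 by rewrite -mulrA f'e2.
have e2f3 : e2 * f3 = f3 by rewrite mulrA e2e2.
have f3t : f3 * t = 0 by rewrite -mulrA f't mulr0.
have tf3 : t * f3 = 0 by rewrite mulrA te2 mul0r.
have o12 : orth_idem f1 (f - f1) by exact: orth_idem_sub.
have o34 : orth_idem f3 (f' - f3) by exact: orth_idem_sub.
pose f2 := f - f1; pose f4 := f' - f3.
have ff2 : f * f2 = f2 by rewrite mulrBr ff ff1.
have f2f : f2 * f = f2 by rewrite mulrBl ff f1f.
have f'f4 : f' * f4 = f4 by rewrite mulrBr f'f' f'f3.
have f4f' : f4 * f' = f4 by rewrite mulrBl f'f' f3f'.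
have cross x y : x * f = x -> f' * y = y -> x * y = 0.
  by move=> <- <-; rewrite -mulrA (mulrA f) ff' mul0r mulr0.
have cross' x y : x * f' = x -> f * y = y -> x * y = 0.
  by move=> <- <-; rewrite -mulrA (mulrA f') f'f mul0r mulr0.
have o24 : orth_idem f2 f4.
  by case: o12 o34 => ? ? ? ? [? ? ? ?]; split=> //; [exact: cross | exact: cross'].
exists f1, f2, f3, f4; split=> //.
- by split=> //; split=> //; [exact: cross | exact: cross'].
- by split; rewrite [RHS]addrC subrK.
- exists (s + f3), (t + e2); split.
    have se2 : s * e2 = 0 by rewrite -sf -mulrA fe2 mulr0.
    by rewrite mulrDl (mulrDr s t) (mulrDr f3 t) f3t f3e2 se2 addr0 add0r addrC subrK.
  by rewrite mulrDl (mulrDr t s) (mulrDr e2 s) tf3 e2s e2f3 addr0 add0r.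
(* Inside the image of [p], both [e'] and [q] span a complement of the image of [e]: [q * (p - s)]
   projects onto the image of [q] and kills [e]. Projecting one complement onto the other gives the
   equivalence. *)
pose q := f2 + f4; pose p := f + f'.
have f4e2 : f4 * e2 = 0 by rewrite mulrBl f'e2 f3e2 subrr.
have ese : e - s * e = e2 by rewrite -[in s * e]sf -mulrA.
have pise : q * (p - s) * e = 0.
  have pe : p * e = e by rewrite /p -eqp mulrDl ee e'e addr0.
  rewrite -mulrA mulrBl pe ese mulrDl f4e2 addr0 -f2f -mulrA fe2.
  by rewrite mulr0.
have sp : s * p = s.
  by rewrite mulrDr sf -[s in s * f']sf -mulrA ff' mulr0 addr0.
have pp : p * p = p by apply: orth_idemD.
have sq : s * q = 0.
  rewrite mulrDr {1}mulrBr sf mulrA sts subrr add0r.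
  by rewrite -sf -mulrA (cross f) // mulr0.
have pq : p * q = q.
  rewrite mulrDl (mulrDr f f2) (mulrDr f' f2) ff2 f'f4 (cross f) // (cross' f') //.
  by rewrite addr0 add0r.
have qq : q * q = q by apply: orth_idemD.
have piq : q * (p - s) * e' = q * (p - s).
  have : q * (p - s) * (e + e') = q * (p - s).
    by rewrite eqp -/p -mulrA mulrBl pp sp.
  by rewrite mulrDr pise add0r.
exists (e' * q), (q * (p - s)); split; last first.
  by rewrite mulrA piq -mulrA mulrBl pq sq subr0 qq.
have e'f3 : e' * f3 = 0 by rewrite mulrA -ee2 mulrA e'e !mul0r.
have e'q : e' * q = e' - e' * f1.
  have -> : q = p - f1 - f3 by rewrite -[RHS]addrA [RHS]addrACA.
  by rewrite !mulrBr e'f3 subr0 /p -eqp mulrDr e'e e'e' add0r.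
rewrite mulrA -[e' * q * q]mulrA qq e'q.
have e'p : e' * p = e' by rewrite /p -eqp mulrDr e'e e'e' add0r.
have f1p : f1 * p = f1 by rewrite -mulrA sp.
have e's : e' * s = 0 by rewrite -es mulrA e'e mul0r.
rewrite mulrBl !mulrBr e'p e's subr0 -!(mulrA e' f1) f1p -[f1 * s]mulrA ss -/f1.
by rewrite subrr subr0.
Qed.

End Idempotents.

(** * Left ideals, their closures, and general comparability *)

Section ContinuousRegular.
Variable S : pzRingType.
Hypothesis regS : regular_ring S.
Hypothesis csS : CS_module (S^o : lmodType S).
Implicit Types (a b c e g s t x y z : S) (A : set S).

Definition left_ideal A : Prop :=
  A 0 /\ forall a u v, A u -> A v -> A (a * u + v).

Lemma left_idealP A : left_ideal A <-> submodule (A : set S^o).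
Proof.
split=> [[A0 AD]|[A0 AD]]; split.
- exact: mem_set.
- by move=> a u v /set_mem Au /set_mem Av; apply: mem_set; apply: AD.
- exact: set_mem A0.
- by move=> a u v Au Av; apply: set_mem (AD a _ _ (mem_set Au) (mem_set Av)).
Qed.

Lemma left_idealD A u v : left_ideal A -> A u -> A v -> A (u + v).
Proof. by case=> _ AD Au Av; rewrite -[u]mul1r; apply: AD. Qed.

Lemma left_idealM A a u : left_ideal A -> A u -> A (a * u).
Proof. by case=> A0 AD Au; rewrite -[_ * _]addr0; apply: AD. Qed.

(** A direct summand of [S] is generated by the component [b] of [1] in it. Essentiality is kept
    only as tested on principal left ideals [S c]. *)
Lemma left_ideal_closure A : left_ideal A ->
  exists b, [/\ b * b = b, (forall v, A v -> v * b = v)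
    & forall c, c * b = c -> (forall r, A (r * c) -> r * c = 0) -> c = 0].
Proof.
move=> idA; have [B [sB [B' [sB' BB' Bsum]]] [AB ess]] := csS (iffLR (left_idealP A) idA).
have idB : left_ideal B := iffRL (left_idealP B) sB.
have idB' : left_ideal B' := iffRL (left_idealP B') sB'.
have B0 (v : S) : B v -> B' v -> v = 0.
  by move=> Bv B'v; have : ([set 0] : set S^o)%classic v by rewrite -BB'.
have [b Bb [b' B'b' b1]] : exists2 b : S, B b & exists2 b' : S, B' b' & 1 = b + b' := Bsum 1.
have Bmul (v : S) : B v -> v * b = v.
  move=> Bv; have vE : v = v * b + v * b' by rewrite -mulrDr -b1 mulr1.
  have vb' : v * b' = v + (- 1) * (v * b) by rewrite {2}vE mulN1r addrC addKr.
  suff vb'0 : v * b' = 0 by rewrite {2}vE vb'0 addr0.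
  apply: B0; last exact: (left_idealM _ idB').
  rewrite vb'; apply: (left_idealD idB) => //.
  by apply: (left_idealM _ idB); apply: (left_idealM _ idB).
exists b; split=> [||c cb cA]; [exact: Bmul | by move=> v /AB; exact: Bmul |].
have Bc : B c by rewrite -cb; apply: (left_idealM _ idB).
pose C : set S^o := [set v | exists r, v = r * c]%classic.
suff : C = [set 0]%classic.
  move=> C0; suff : ([set 0]%classic : set S^o) c by [].
  by rewrite -C0; exists 1; rewrite mul1r.
apply: ess; first apply: (iffLR (left_idealP C)); first split.
- by exists 0; rewrite mul0r.
- by move=> a _ _ [r ->] [r' ->]; exists (a * r + r'); rewrite mulrDl mulrA.
- by move=> _ [r ->]; apply: (left_idealM _ idB).
- apply/seteqP; split=> [v [Av [r vE]]|v ->].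
    by move: Av; rewrite vE => /cA.
  split; first by case: idA.
  by exists 0; rewrite mul0r.
Qed.

(* A von Neumann regular ring is nonsingular: an element killing a left ideal
   on the right also kills its essential closure. *)
Lemma left_ideal_closure_ann A b k : (forall v, A v -> v * k = 0) ->
  b * b = b ->
  (forall c, c * b = c -> (forall r, A (r * c) -> r * c = 0) -> c = 0) ->
  b * k = 0.
Proof.
move=> Ak bb ess; suff : forall u, b * k = u -> u = 0 by apply.
move=> u bk; have [s us] := regS u.
(* If [r * (u * s * b)] lies in [A], multiplying it by [k] gives [r * u = 0], because
   [b * k = u]. *)
have c0 : u * s * b = 0.
  apply: ess => [|r Ac]; first by rewrite -mulrA bb.
  have ru : r * u = 0.
    by have := Ak _ Ac; rewrite -!mulrA bk !mulrA => E; rewrite us !mulrA.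
  by rewrite 2!mulrA ru !mul0r.
by rewrite us -[X in _ * X]bk mulrA c0 mul0r.
Qed.

(** The [v] with [v S y = 0] form a two-sided ideal [J] containing [x]. By nonsingularity the
    idempotent [g] of its closure lies in [J], so [J = S g], and regularity forces such a [g] to be
    central. *)
Lemma central_idem_separation x y : (forall s, x * s * y = 0) ->
  exists g, [/\ g * g = g, (forall s, g * s = s * g), x * g = x & g * y = 0].
Proof.
move=> xy; pose J : set S := fun v => forall s, v * s * y = 0.
have idJ : left_ideal J.
  split=> [s|a u v Ju Jv s]; first by rewrite !mul0r.
  by rewrite !mulrDl -!mulrA (mulrA u) Ju mulr0 add0r mulrA Jv.
have [g [gg gJ ess]] := left_ideal_closure idJ.
have Jg : J g.
  by move=> s; rewrite -mulrA; apply: (left_ideal_closure_ann _ gg ess) => v Jv;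
     rewrite mulrA.
have gsg s : g * s * g = g * s.
  by apply: gJ => t; rewrite -(mulrA g).
exists g; split=> // [s||]; last 2 first.
- exact: gJ.
- by rewrite -[g]mulr1.
(* This difference [w] is a left multiple of [g] with [g * v * w = 0], so [w = w * v * w] vanishes
   for a quasi-inverse [v]. *)
suff : s * g - g * (s * g) = 0.
  by move/eqP; rewrite subr_eq0 mulrA gsg => /eqP.
have [v] := regS (s * g - g * (s * g)).
have : g * v * (s * g - g * (s * g)) = 0 by rewrite mulrBr !mulrA gsg subrr.
set w := (X in _ * X = 0 -> _) => gvw ->.
by rewrite -mulrA mulrBl -/w -!mulrA (mulrA g v) gvw !mulr0 subrr.
Qed.

(** Right multiplication by [x] embeds [S b] into [S x]. By regularity its image [S b x] is
    generated by an idempotent [x'] below [x]. *)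
Lemma idem_image b x : b * b = b -> x * x = x ->
  (forall v, v * b = v -> v * x = 0 -> v = 0) ->
  exists x', [/\ x' * x' = x', x * x' = x', x' * x = x', b * x * x' = b * x
    & exists a c, a * c = b /\ c * a = x'].
Proof.
move=> bb xx inj; have [c cE] := regS (b * x).
have bxE : b * x * (x * c * b * x) = b * x.
  by rewrite !mulrA -(mulrA b x x) xx [RHS]cE !mulrA.
exists (x * c * b * x); split=> //.
- by rewrite -{1}(mulrA _ b x) -mulrA bxE mulrA.
- by rewrite !mulrA xx.
- by rewrite -mulrA xx.
exists (b * x), (x * c * b); split; last by rewrite mulrA -(mulrA _ b b) bb.
apply/eqP; rewrite -subr_eq0; apply/eqP; apply: inj.
- by rewrite mulrBl bb -!mulrA bb.
- by rewrite mulrBl -mulrA bxE subrr.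
Qed.

(** A maximal isomorphism between submodules of [S x] and [S y] has a graph equal to its closure
    [S b], and the projections of [S b] yield [x1] and [y1]. A nonzero [x2 * s * y2] would enlarge
    the graph. *)
Lemma orth_idem_comparability x y : orth_idem x y ->
  exists x1 x2 y1 y2,
    [/\ orth_idem x1 x2, orth_idem y1 y2, x = x1 + x2 /\ y = y1 + y2,
        exists a c, a * c = x1 /\ c * a = y1
      & forall s, x2 * s * y2 = 0].
Proof.
case=> xx yy xy yx.
(* [P G] says that [G] is the graph of an isomorphism from a submodule of
   [S x] to a submodule of [S y] (or is empty, for the sake of empty chains). *)
pose P (G : set S) := (forall a u v, G u -> G v -> G (a * u + v)) /\
  forall v, G v -> [/\ v * x + v * y = v, v * x = 0 -> v = 0 & v * y = 0 -> v = 0].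
have [F PF totF|G [[GD Gxy] maxG]] := @Zorn_bigcup S P.
  split=> [a u v [G1 FG1 G1u] [G2 FG2 G2v]|v [G FG Gv]]; last first.
    by have [_] := PF _ FG; apply.
  have [le12|le21] := totF _ _ FG1 FG2.
    by exists G2 => //; have [GD _] := PF _ FG2; apply: GD => //; apply: le12.
  by exists G1 => //; have [GD _] := PF _ FG1; apply: GD => //; apply: le21.
have Gmax (H : set S) : P H -> (G `<=` H)%classic -> (H `<=` G)%classic.
  by move=> PH GH; apply: contrapT => HG; apply: (maxG H).
have G0 : G 0.
  case: (pselect (exists v, G v)) => [[v Gv]|Gempty].
    by rewrite -(addNr v) -mulN1r; apply: GD.
  apply: (Gmax [set 0]%classic) => //; last by move=> v Gv; case: Gempty; exists v.
  split=> [a u v -> ->|v ->]; first by rewrite mulr0 addr0.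
  by rewrite !mul0r addr0.
have idG : left_ideal G by split.
have [b [bb Gb ess]] := left_ideal_closure idG.
have bw : b * (1 - (x + y)) = 0.
  apply: (left_ideal_closure_ann _ bb ess) => v /Gxy[vE _ _].
  by rewrite mulrBr mulr1 mulrDr vE subrr.
(* The closure [S b] is again a graph: if [x] or [y] kills [v] in [S b], it kills the multiples of
   [v] lying in [G], so these are zero and essentiality gives [v = 0]. *)
have Pb : P [set v | v * b = v]%classic.
  split=> [a u v /= ub vb|v /= vb]; first by rewrite mulrDl -mulrA ub vb.
  split.
  - rewrite -mulrDr -vb -mulrA; congr (_ * _); apply/eqP.
    by rewrite eq_sym -subr_eq0 -{1}[b]mulr1 -mulrBr bw.
  - move=> vx; apply: ess => // r /Gxy[_ + _]; apply.
    by rewrite -mulrA vx mulr0.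
  - move=> vy; apply: ess => // r /Gxy[_ _]; apply.
    by rewrite -mulrA vy mulr0.
have bG v : v * b = v -> G v by apply: (Gmax _ Pb) => u; apply: Gb.
have [|x' [x'x' xx' x'x bxx' [a [c [acb cax]]]]] := @idem_image b x bb xx.
  by move=> v vb; case: (Gxy _ (bG _ vb)).
have [|y' [y'y' yy' y'y byy' [a' [c' [acb' cay]]]]] := @idem_image b y bb yy.
  by move=> v vb; case: (Gxy _ (bG _ vb)).
have ox := orth_idem_sub xx x'x' x'x xx'.
have oy := orth_idem_sub yy y'y' y'y yy'.
exists x', (x - x'), y', (y - y'); split=> //.
- by split; rewrite [RHS]addrC subrK.
- exists (c * a'), (c' * a); split.
    rewrite -mulrA (mulrA a') acb' -acb !mulrA -!(mulrA (c * a)).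
    by rewrite cax x'x'.
  rewrite -mulrA (mulrA a) acb -acb' !mulrA -!(mulrA (c' * a')).
  by rewrite cay y'y'.
move=> s.
have [_ x''x'' _ _] := ox; have [_ y''y'' _ _] := oy.
have x''x : (x - x') * x = x - x' by rewrite mulrBl xx x'x.
have y''y : (y - y') * y = y - y' by rewrite mulrBl yy y'y.
have bx'' : b * x * (x - x') = 0 by rewrite mulrBr bxx' -mulrA xx subrr.
have by'' : b * y * (y - y') = 0 by rewrite mulrBr byy' -mulrA yy subrr.
move: (x - x') (y - y') x''x'' y''y'' x''x y''y bx'' by'' {ox oy}.
move=> x'' y'' x''x'' y''y'' x''x y''y bx'' by''.
have [t'] := regS (x'' * s * y''); set t := x'' * s * y'' => tE.
have x''t : x'' * t = t by rewrite !mulrA x''x''.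
have ty'' : t * y'' = t by rewrite -mulrA y''y''.
have ty : t * y = t by rewrite -mulrA y''y.
have tx : t * x = 0 by rewrite -ty -mulrA yx mulr0.
have gx'' v : G v -> v * x * x'' = 0.
  by move=> Gv; rewrite -(Gb v Gv) -!mulrA (mulrA b) bx'' mulr0.
have gy'' v : G v -> v * y * y'' = 0.
  by move=> Gv; rewrite -(Gb v Gv) -!mulrA (mulrA b) by'' mulr0.
(* If [t] were nonzero, [z |-> t] would extend the graph [G]. *)
pose z := t * t' * x''.
have zt : z * t = t by rewrite -mulrA x''t.
have zx'' : z * x'' = z by rewrite -mulrA x''x''.
have zx : z * x = z by rewrite -mulrA x''x.
have zy : z * y = 0 by rewrite -zx -mulrA xy mulr0.
have PG' : P [set v | exists g r, G g /\ v = g + r * (z + t)]%classic.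
  split=> [d _ _ /= [g [r [Gg ->]]] [g' [r' [Gg' ->]]]|_ /= [g [r [Gg ->]]]].
    exists (d * g + g'), (d * r + r'); split; first exact: GD.
    by rewrite mulrDr mulrDl !mulrA addrACA.
  have [gE gx0 gy0] := Gxy _ Gg.
  have vx : (g + r * (z + t)) * x = g * x + r * z.
    by rewrite mulrDl -mulrA (mulrDl z) zx tx addr0.
  have vy : (g + r * (z + t)) * y = g * y + r * t.
    by rewrite mulrDl -mulrA (mulrDl z) zy ty add0r.
  split=> [|v0|v0].
  - by rewrite vx vy addrACA gE -mulrDr.
  - have rz : r * z = 0.
      by have := congr1 ( *%R^~ x'') v0; rewrite vx mulrDl gx'' // add0r -mulrA zx'' mul0r.
    have rt : r * t = 0 by rewrite -zt mulrA rz mul0r.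
    by rewrite mulrDr rz rt !addr0 gx0 // -[LHS]addr0 -[in LHS]rz -vx.
  - have rt : r * t = 0.
      by have := congr1 ( *%R^~ y'') v0; rewrite vy mulrDl gy'' // add0r -mulrA ty'' mul0r.
    have rz : r * z = 0 by rewrite 2!mulrA rt !mul0r.
    by rewrite mulrDr rz rt !addr0 gy0 // -[LHS]addr0 -[in LHS]rt -vy.
have Gv0 : G (z + t).
  apply: (Gmax _ PG'); first by move=> v Gv; exists v, 0; rewrite mul0r addr0.
  by exists 0, 1; rewrite mul1r add0r.
(* Elements of [G] have no component in [S x''], but that of [z + t] is [z]. *)
have := gx'' _ Gv0; rewrite (mulrDl z) zx tx addr0 zx'' => z0.
by rewrite -zt z0 mul0r.
Qed.

End ContinuousRegular.

(** * Regularity of rectangular matrices *)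

Section RegularMatrices.
Variable S : pzRingType.

(* McCoy's lemma. *)
Lemma regular_mx_sub m n (A : 'M[S]_(m, n)) (C : 'M_(n, m)) :
  (exists B, (A - A *m C *m A) *m B *m (A - A *m C *m A) = A - A *m C *m A) ->
  exists B, A *m B *m A = A.
Proof.
case=> B BE; exists (C + (1%:M - C *m A) *m B *m (1%:M - A *m C)).
have l : A *m (1%:M - C *m A) = A - A *m C *m A.
  by rewrite mulmxBr mulmx1 mulmxA.
have r : (1%:M - A *m C) *m A = A - A *m C *m A by rewrite mulmxBl mul1mx.
by rewrite mulmxDr mulmxDl !mulmxA l -(mulmxA _ (1%:M - A *m C)) r BE addrC subrK.
Qed.

(** Induction on columns for a single row, then on rows. An inner inverse of the first entry,
    respectively of the first row, lets McCoy's lemma clear it and leaves a smaller matrix. *)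
Lemma regular_mx : regular_ring S ->
  forall m n (A : 'M[S]_(m, n)), exists B, A *m B *m A = A.
Proof.
move=> regS; have reg1 n (A : 'M[S]_(1, n)) : exists B, A *m B *m A = A.
  elim: n A => [|n IHn] A; first by exists 0; rewrite [RHS]thinmx0 thinmx0.
  move: A; rewrite -[n.+1]add1n => A.
  pose r := rsubmx A; pose a := lsubmx A 0 0.
  have AE : A = row_mx a%:M r by rewrite -[LHS]hsubmxK [lsubmx A]mx11_scalar.
  have [b bE] := regS a.
  apply: (@regular_mx_sub _ _ A (col_mx b%:M 0)).
  have -> : A - A *m col_mx b%:M 0 *m A = row_mx 0 (r - (a * b)%:M *m r).
    rewrite AE mul_row_col mulmx0 addr0 -scalar_mxM.
    by rewrite mul_mx_row -scalar_mxM -bE opp_row_mx add_row_mx subrr.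
  have [B BE] := IHn (r - (a * b)%:M *m r).
  exists (col_mx 0 B).
  by rewrite mul_row_col mulmx0 add0r mul_mx_row mulmx0 BE.
elim=> [|m IHm] n A; first by exists 0; rewrite [RHS]flatmx0 flatmx0.
move: A; rewrite -[m.+1]add1n => A.
pose a := usubmx A; pose A' := dsubmx A.
have [s sE] := reg1 _ a.
apply: (@regular_mx_sub _ _ A (row_mx s 0)).
have -> : A - A *m row_mx s 0 *m A = col_mx 0 (A' - A' *m s *m a).
  rewrite -[A]vsubmxK -/a -/A' -mulmxA mul_row_col mul0mx addr0.
  by rewrite mul_col_mx !mulmxA sE opp_col_mx add_col_mx subrr.
have [B BE] := IHm _ (A' - A' *m s *m a).
exists (row_mx 0 B).
by rewrite mul_col_row mul_block_col !mul0mx !mulmx0 !addr0 add0r BE.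
Qed.

End RegularMatrices.

(** * The monoid of equivalence classes of idempotent matrices *)

Section IdempotentMonoid.
Variable S : pzRingType.

(* Idempotents [E] and [F] satisfy [sim E F] iff their row spaces are isomorphic
   modules. *)
Definition sim m n (E : 'M[S]_m) (F : 'M[S]_n) : Prop :=
  exists X Y, X *m Y = E /\ Y *m X = F.

Definition mx_sum m n (E : 'M[S]_m) (F : 'M[S]_n) : 'M[S]_(m + n) :=
  block_mx E 0 0 F.

Lemma sim_refl n (E : 'M[S]_n) : E *m E = E -> sim E E.
Proof. by move=> EE; exists E, E. Qed.

Lemma sim_sym m n (E : 'M[S]_m) (F : 'M[S]_n) : sim E F -> sim F E.
Proof. by case=> X [Y [XY YX]]; exists Y, X. Qed.

(** [X] and [Y] need not be cut down by the idempotents: [X *m Z *m W *m Y] equals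
    [X *m Y *m X *m Y], and idempotence of [E] concludes. *)
Lemma sim_trans m n p (E : 'M[S]_m) (F : 'M[S]_n) (G : 'M[S]_p) :
  E *m E = E -> G *m G = G -> sim E F -> sim F G -> sim E G.
Proof.
move=> EE GG [X [Y [XY YX]]] [Z [W [ZW WZ]]]; exists (X *m Z), (W *m Y); split.
- by rewrite mulmxA -(mulmxA X) ZW -YX !mulmxA XY -mulmxA XY.
- by rewrite mulmxA -(mulmxA W) YX -ZW !mulmxA WZ -mulmxA WZ.
Qed.

Lemma mx_sum_idem m n (E : 'M[S]_m) (F : 'M[S]_n) :
  E *m E = E -> F *m F = F -> mx_sum E F *m mx_sum E F = mx_sum E F.
Proof.
by move=> EE FF; rewrite mulmx_block !mulmx0 !mul0mx !addr0 add0r EE FF.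
Qed.

Lemma sim_mx_sum m n m' n' (E : 'M[S]_m) (F : 'M[S]_n) (E' : 'M[S]_m') (F' : 'M[S]_n') :
  sim E E' -> sim F F' -> sim (mx_sum E F) (mx_sum E' F').
Proof.
move=> [X [Y [XY YX]]] [Z [W [ZW WZ]]].
exists (block_mx X 0 0 Z), (block_mx Y 0 0 W).
by rewrite !mulmx_block !mulmx0 !mul0mx !addr0 !add0r XY YX ZW WZ.
Qed.

Lemma sim_mx_sumP m n p (E : 'M[S]_m) (F : 'M[S]_n) (G : 'M[S]_p) U V U' V' :
  U *m V + U' *m V' = G -> V *m U = E -> V' *m U' = F -> V *m U' = 0 -> V' *m U = 0 ->
  sim G (mx_sum E F).
Proof.
move=> UV VU VU' V0 V0'; exists (row_mx U U'), (col_mx V V').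
by rewrite mul_row_col mul_col_row UV VU VU' V0 V0'.
Qed.

Lemma sim_mx_sumC m n (E : 'M[S]_m) (F : 'M[S]_n) :
  E *m E = E -> F *m F = F -> sim (mx_sum E F) (mx_sum F E).
Proof.
move=> EE FF; exists (block_mx 0 E F 0), (block_mx 0 F E 0).
by rewrite !mulmx_block !mulmx0 !mul0mx !addr0 !add0r EE FF.
Qed.

Lemma sim_mx_sum0 n (E : 'M[S]_n) : E *m E = E -> sim (mx_sum (0 : 'M_0) E) E.
Proof.
move=> EE; apply: sim_sym; apply: (@sim_mx_sumP _ _ _ _ _ _ 0 0 E E);
  by rewrite ?mul0mx ?mulmx0 ?add0r.
Qed.

Lemma sim_mx_sumA m n p (E : 'M[S]_m) (F : 'M[S]_n) (G : 'M[S]_p) :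
  E *m E = E -> F *m F = F -> G *m G = G ->
  sim (mx_sum E (mx_sum F G)) (mx_sum (mx_sum E F) G).
Proof.
move=> EE FF GG.
apply: (@sim_mx_sumP _ _ _ _ _ _ (block_mx E 0 0 (col_mx F 0)) (block_mx E 0 0 (row_mx F 0))
   (col_mx 0 (col_mx 0 G)) (row_mx 0 (row_mx 0 G))).
- rewrite mulmx_block !mul_col_row !mul_mx_row !mul_col_mx !mulmx0 !mul0mx.
  by rewrite !row_mx0 !col_mx0 !addr0 !add0r !add_block_mx EE FF GG !addr0 add0r.
- by rewrite mulmx_block mul_row_col !mulmx0 !mul0mx !addr0 !add0r EE FF.
- by rewrite !mul_row_col !mul0mx !add0r GG.
- by rewrite mul_block_col !mulmx0 mul_row_col !mulmx0 !mul0mx !addr0 col_mx0.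
- by rewrite mul_row_block !mul0mx mul_row_col !mulmx0 !mul0mx !addr0 row_mx0.
Qed.

Definition idempotent_mx := {E : {n : nat & 'M[S]_n} | tagged E *m tagged E == tagged E}.

Lemma idempotent_mxP (E : idempotent_mx) :
  tagged (val E) *m tagged (val E) = tagged (val E).
Proof. exact/eqP/(valP E). Qed.

Definition simb (E F : idempotent_mx) : bool := `[< sim (tagged (val E)) (tagged (val F)) >].

Lemma simb_refl : reflexive simb.
Proof. by move=> E; apply/asboolP/sim_refl/idempotent_mxP. Qed.

Lemma simb_sym : symmetric simb.
Proof. by move=> E F; apply/asboolP/asboolP; apply: sim_sym. Qed.

Lemma simb_trans : transitive simb.
Proof.
move=> E F G /asboolP FE /asboolP EG; apply/asboolP.
by apply: (sim_trans _ _ FE EG); apply: idempotent_mxP.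
Qed.

Definition sim_equiv := EquivRel simb simb_refl simb_sym simb_trans.

(* The monoid of isomorphism classes of finitely generated projective left
   [S]-modules, each represented by an idempotent matrix of any size. *)
Definition Vmonoid := {eq_quot sim_equiv}%qT.
HB.instance Definition _ := Choice.on Vmonoid.
HB.instance Definition _ := EqQuotient.on Vmonoid.

Definition idempotent_mx0 : idempotent_mx :=
  exist _ (Tagged (fun n => 'M[S]_n) (0 : 'M_0)) (introT eqP (mul0mx _ _)).

(* Junk value: a matrix that is not idempotent is sent to the empty matrix. *)
Definition to_idem n (E : 'M[S]_n) : idempotent_mx :=
  insubd idempotent_mx0 (Tagged (fun n => 'M[S]_n) E).

Definition cls n (E : 'M[S]_n) : Vmonoid := (\pi_Vmonoid (to_idem E))%qT.


Lemma to_idemK n (E : 'M[S]_n) : E *m E = E ->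
  val (to_idem E) = Tagged (fun n => 'M[S]_n) E.
Proof. by move=> EE; rewrite insubdK //; apply/eqP. Qed.

Lemma cls_eqP m n (E : 'M[S]_m) (F : 'M[S]_n) : E *m E = E -> F *m F = F ->
  cls E = cls F <-> sim E F.
Proof.
move=> EE FF; rewrite /cls; split=> [/eqmodP/asboolP|simEF].
  by rewrite !to_idemK.
by apply/eqmodP/asboolP; rewrite !to_idemK.
Qed.

Lemma clsW (a : Vmonoid) : exists n (E : 'M[S]_n), E *m E = E /\ a = cls E.
Proof.
elim/quotW: a => E; exists (tag (val E)), (tagged (val E)).
have EE := idempotent_mxP E; split=> //.
by apply/eqmodP/asboolP; rewrite to_idemK //; apply: sim_refl.
Qed.

Definition Vadd (a b : Vmonoid) : Vmonoid :=
  cls (mx_sum (tagged (val (repr a))) (tagged (val (repr b)))).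

Definition Vzero : Vmonoid := cls (0 : 'M[S]_0).

Lemma sim_repr n (E : 'M[S]_n) : E *m E = E -> sim (tagged (val (repr (cls E)))) E.
Proof.
move=> EE; apply/cls_eqP => //; first exact: idempotent_mxP.
rewrite -[RHS]reprK; apply/eqmodP/asboolP; rewrite to_idemK; last exact: idempotent_mxP.
by apply: sim_refl; apply: idempotent_mxP.
Qed.

Lemma Vadd_cls m n (E : 'M[S]_m) (F : 'M[S]_n) : E *m E = E -> F *m F = F ->
  Vadd (cls E) (cls F) = cls (mx_sum E F).
Proof.
move=> EE FF; apply/cls_eqP.
- by apply: mx_sum_idem; apply: idempotent_mxP.
- exact: mx_sum_idem.
- by apply: sim_mx_sum; apply: sim_repr.
Qed.

Lemma VaddA : associative Vadd.
Proof.
move=> a b c; have [m [E [EE ->]]] := clsW a; have [n [F [FF ->]]] := clsW b.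
have [p [G [GG ->]]] := clsW c.
rewrite !Vadd_cls //; try exact: mx_sum_idem.
by apply/cls_eqP; do ?apply: mx_sum_idem => //; apply: sim_mx_sumA.
Qed.

Lemma VaddC : commutative Vadd.
Proof.
move=> a b; have [m [E [EE ->]]] := clsW a; have [n [F [FF ->]]] := clsW b.
rewrite !Vadd_cls //.
by apply/cls_eqP; do ?apply: mx_sum_idem => //; apply: sim_mx_sumC.
Qed.

Lemma Vadd0r : left_id Vzero Vadd.
Proof.
move=> a; have [m [E [EE ->]]] := clsW a.
have ZZ : (0 : 'M[S]_0) *m (0 : 'M[S]_0) = 0 by exact: mul0mx.
rewrite Vadd_cls //.
by apply/cls_eqP; [exact: (mx_sum_idem ZZ EE) | | exact: sim_mx_sum0].
Qed.

HB.instance Definition _ := GRing.isNmodule.Build Vmonoid VaddA VaddC Vadd0r.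

Lemma cls_mx_sum m n (E : 'M[S]_m) (F : 'M[S]_n) : E *m E = E -> F *m F = F ->
  cls (mx_sum E F) = cls E + cls F.
Proof. by move=> EE FF; rewrite -[RHS]/(Vadd _ _) Vadd_cls. Qed.

Lemma cls_orth n (E F : 'M[S]_n) :
  E *m E = E -> F *m F = F -> E *m F = 0 -> F *m E = 0 -> cls (E + F) = cls E + cls F.
Proof.
move=> EE FF EF FE; rewrite -cls_mx_sum //; apply/cls_eqP.
- by rewrite mulmxDl !mulmxDr EE FF EF FE addr0 add0r.
- exact: mx_sum_idem.
- by apply: (@sim_mx_sumP _ _ _ _ _ _ E E F F); rewrite ?EE ?FF.
Qed.

(** An equivalence between [P] and a block sum representing [a + b] carries the diagonal idempotents
    [I1 *m J1] and [I2 *m J2] back to orthogonal idempotents inside [P]. *)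
Lemma cls_split n (P : 'M[S]_n) (a b : Vmonoid) : P *m P = P -> cls P = a + b ->
  exists E F : 'M[S]_n, [/\ E *m E = E, F *m F = F, E *m F = 0, F *m E = 0
    & [/\ E + F = P, cls E = a & cls F = b]].
Proof.
move=> PP; have [m [E [EE ->]]] := clsW a; have [k [F [FF ->]]] := clsW b.
rewrite -cls_mx_sum // => /cls_eqP[]//; first exact: mx_sum_idem.
move=> X [Y [XY YX]].
pose I1 : 'M[S]_(m + k, m) := col_mx E 0; pose J1 : 'M[S]_(m, m + k) := row_mx E 0.
pose I2 : 'M[S]_(m + k, k) := col_mx 0 F; pose J2 : 'M[S]_(k, m + k) := row_mx 0 F.
have J1I1 : J1 *m (Y *m X) *m I1 = E.
  by rewrite YX mul_row_block mul_row_col !mulmx0 ?mul0mx !addr0 !EE.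
have J2I2 : J2 *m (Y *m X) *m I2 = F.
  by rewrite YX mul_row_block mul_row_col !mulmx0 ?mul0mx !add0r !FF.
have J1I2 : J1 *m (Y *m X) *m I2 = 0.
  by rewrite YX mul_row_block mul_row_col !mulmx0 ?mul0mx !addr0 ?mul0mx ?addr0.
have J2I1 : J2 *m (Y *m X) *m I1 = 0.
  by rewrite YX mul_row_block mul_row_col !mulmx0 ?mul0mx !add0r ?mul0mx ?addr0.
have I1E : I1 *m E = I1 by rewrite mul_col_mx EE mul0mx.
have I2F : I2 *m F = I2 by rewrite mul_col_mx FF mul0mx.
have mulE p q (J : 'M[S]_(p, m + k)) (I : 'M_(m + k, q)) A B :
  (X *m A *m (J *m Y)) *m (X *m I *m B) = X *m A *m (J *m (Y *m X) *m I) *m B :> 'M_n.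
  by rewrite !mulmxA.
have idE : X *m I1 *m (J1 *m Y) *m (X *m I1 *m (J1 *m Y)) = X *m I1 *m (J1 *m Y).
  by rewrite mulE J1I1 -(mulmxA X) I1E.
have idF : X *m I2 *m (J2 *m Y) *m (X *m I2 *m (J2 *m Y)) = X *m I2 *m (J2 *m Y).
  by rewrite mulE J2I2 -(mulmxA X) I2F.
exists (X *m I1 *m (J1 *m Y)), (X *m I2 *m (J2 *m Y)); split=> //.
- by rewrite mulE J1I2 mulmx0 mul0mx.
- by rewrite mulE J2I1 mulmx0 mul0mx.
split.
- have IJ : I1 *m J1 + I2 *m J2 = Y *m X.
    by rewrite YX !mul_col_row add_block_mx EE FF !mulmx0 ?mul0mx !addr0 !add0r.
  have -> : X *m I1 *m (J1 *m Y) + X *m I2 *m (J2 *m Y) = X *m (I1 *m J1 + I2 *m J2) *m Y.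
    by rewrite mulmxDr mulmxDl !mulmxA.
  by rewrite IJ !mulmxA XY -mulmxA XY PP.
- apply/cls_eqP => //; exists (X *m I1), (J1 *m Y); split=> //.
  by rewrite mulmxA -(mulmxA J1) J1I1.
- apply/cls_eqP => //; exists (X *m I2), (J2 *m Y); split=> //.
  by rewrite mulmxA -(mulmxA J2) J2I2.
Qed.

End IdempotentMonoid.

(** * Cutting by a central idempotent *)

Section CentralCut.
Variables (S : pzRingType) (g : S).
Hypotheses (gg : g * g = g) (gC : forall s, g * s = s * g).

Lemma central_scalar_mxC m n (A : 'M[S]_(m, n)) : A *m g%:M = g%:M *m A.
Proof.
rewrite mul_scalar_mx; apply/matrixP=> i j; rewrite !mxE (bigD1 j) //= !mxE eqxx.
by rewrite mulr1n big1 ?addr0 // => k /negPf kj; rewrite !mxE kj mulr0n mulr0.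
Qed.

Lemma cut_idem n (E : 'M[S]_n) : E *m E = E ->
  (g%:M *m E) *m (g%:M *m E) = g%:M *m E.
Proof.
move=> EE; rewrite mulmxA -(mulmxA _ E) central_scalar_mxC mulmxA -scalar_mxM gg.
by rewrite -mulmxA EE.
Qed.

Lemma sim_cut m n (E : 'M[S]_m) (F : 'M[S]_n) : sim E F ->
  sim (g%:M *m E) (g%:M *m F).
Proof.
case=> X [Y [<- <-]]; exists (g%:M *m X), Y; split; first by rewrite mulmxA.
by rewrite !mulmxA central_scalar_mxC.
Qed.

Lemma mx_sum_cut m n (E : 'M[S]_m) (F : 'M[S]_n) :
  g%:M *m mx_sum E F = mx_sum (g%:M *m E) (g%:M *m F).
Proof. by rewrite scalar_mx_block mulmx_block !mulmx0 !mul0mx !addr0 add0r. Qed.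

(** Multiplication by [g%:M] respects [sim] and [mx_sum], so it acts additively on classes. *)
Lemma clsD_cut m n p q (E : 'M[S]_m) (F : 'M[S]_n) (E' : 'M[S]_p) (F' : 'M[S]_q) :
  E *m E = E -> F *m F = F -> E' *m E' = E' -> F' *m F' = F' ->
  cls E + cls F = cls E' + cls F' ->
  cls (g%:M *m E) + cls (g%:M *m F) = cls (g%:M *m E') + cls (g%:M *m F').
Proof.
move=> EE FF EE' FF'; rewrite -!cls_mx_sum ?cut_idem //.
move/cls_eqP => -[||X [Y XY]]; [exact: mx_sum_idem.. |].
by apply/cls_eqP; rewrite -?mx_sum_cut; [exact: cut_idem (mx_sum_idem _ _)..|
  apply: sim_cut; exists X, Y].
Qed.

Lemma cls_cutD n (E : 'M[S]_n) : E *m E = E ->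
  cls E = cls (g%:M *m E) + cls ((1 - g)%:M *m E).
Proof.
move=> EE; rewrite raddfB /= mulmxBl mul1mx.
have gE := cut_idem EE.
have gEE : E *m (g%:M *m E) = g%:M *m E.
  by rewrite mulmxA central_scalar_mxC -mulmxA EE.
rewrite -cls_orth; first by rewrite addrC subrK.
- exact: gE.
- by rewrite mulmxBl !mulmxBr gE gEE -mulmxA EE subrr subr0.
- by rewrite mulmxBr gE -mulmxA EE subrr.
- by rewrite mulmxBl gE gEE subrr.
Qed.

End CentralCut.

(** * Refinement and the algebraic preorder *)

Section Refinement.
Variable S : pzRingType.
Hypothesis regS : regular_ring S.
Local Notation V := (Vmonoid S).
Implicit Types a b c d : V.

(** Both decompositions are realised by idempotents of one matrix ring, where regularity of matrices
    makes [orth_idem_refinement] applicable. *)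
Lemma V_refinement a b c d : a + b = c + d ->
  exists x y z w, [/\ a = x + y, b = z + w, c = x + z & d = y + w].
Proof.
move=> abcd; have [n [P [PP PE]]] := clsW (a + b).
have [E [E' [EE EE' EoE' E'oE [EP <- <-]]]] := cls_split PP (esym PE).
rewrite abcd in PE.
have [F [F' [FF FF' FoF' F'oF [FP <- <-]]]] := cls_split PP (esym PE).
have [s0 s0E] := regular_mx regS (F *m E).
have [f1 [f2 [f3 [f4 [[o12 o34] [o13 o24] [FE FE'] [x [y [xy yx]]] [z [w [zw wz]]]]]]]] :=
  @orth_idem_refinement 'M[S]_n E E' F F' s0 s0E
   (And4 EE EE' EoE' E'oE) (And4 FF FF' FoF' F'oF) (etrans EP (esym FP)).
have clsD (e f : 'M[S]_n) : orth_idem e f -> cls (e + f) = cls e + cls f.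
  by case; apply: cls_orth.
exists (cls f1), (cls f3), (cls f2), (cls f4); rewrite -!clsD // -FE -FE'.
by split=> //; apply/cls_eqP=> //; [exact: orth_idemD o13 | exists x, y |
   exact: orth_idemD o24 | exists z, w].
Qed.

Definition Vle a b := exists c, a + c = b.

Definition Vunit : V := cls (1%:M : 'M_1).

Lemma Vle_trans a b c : Vle a b -> Vle b c -> Vle a c.
Proof. by move=> [x <-] [y <-]; exists (x + y); rewrite addrA. Qed.

Lemma Vle_addr a b c : Vle a b -> Vle a (b + c).
Proof. by move=> [x <-]; exists (x + c); rewrite addrA. Qed.

Lemma Vle_add_split a b c : Vle a (b + c) ->
  exists a1 a2, [/\ a = a1 + a2, Vle a1 b & Vle a2 c].
Proof.
case=> d /V_refinement[x [y [z [w [-> _ -> ->]]]]].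
by exists x, y; split=> //; [exists z | exists w].
Qed.

(** The class lies below that of an identity matrix, a sum of copies of [Vunit]; refinement
    distributes it over these copies. *)
Lemma V_sum_cyclic a : exists s : seq V,
  a = \sum_(c <- s) c /\ forall c, c \in s -> Vle c Vunit.
Proof.
have [n [E [EE ->]]] := clsW a.
have le1 : Vle (cls E) (cls (1%:M : 'M[S]_n)).
  exists (cls (1%:M - E)); rewrite -cls_orth; first by rewrite addrC subrK.
  - exact: EE.
  - by rewrite mulmxBl !mulmxBr !mul1mx mulmx1 EE subrr subr0.
  - by rewrite mulmxBr mulmx1 EE subrr.
  - by rewrite mulmxBl mul1mx EE subrr.
move: (cls E) le1 => {}a; elim: n a {E EE} => [|n IHn] a.
  case=> b /esym/(cls_split (mulmx1 _)) [E [_ [_ _ _ _ [_ <- _]]]].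
  by exists [::]; rewrite big_nil [E]flatmx0.
rewrite -[n.+1]add1n (scalar_mx_block 1 n) cls_mx_sum ?mulmx1 // -/Vunit.
move/Vle_add_split=> [a1 [a2 [-> a1u /IHn[s [-> sP]]]]].
exists (a1 :: s); rewrite big_cons; split=> // c; rewrite inE => /orP[/eqP -> //|].
exact: sP.
Qed.

End Refinement.

(** * Cancellation and separativity *)

Section Cancellation.
Variable S : pzRingType.
Hypothesis regS : regular_ring S.
Hypothesis csS : CS_module (S^o : lmodType S).
Local Notation V := (Vmonoid S).
Local Notation cyc e := (cls (e%:M : 'M[S]_1)).
Implicit Types a b c d : V.

Lemma scalar_idem e : e * e = e -> e%:M *m e%:M = e%:M :> 'M[S]_1.
Proof. by rewrite -scalar_mxM => ->. Qed.

Lemma cycD (e f : S) : orth_idem e f -> cyc (e + f) = cyc e + cyc f.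
Proof.
by case=> ee ff ef fe; rewrite raddfD /= cls_orth // -scalar_mxM ?ee ?ff ?ef ?fe // raddf0.
Qed.

Lemma cyc_split (e : S) a b : e * e = e -> cyc e = a + b ->
  exists x y, [/\ orth_idem x y, x + y = e, cyc x = a & cyc y = b].
Proof.
move=> ee /(cls_split (scalar_idem ee)) [E [F [EE FF EF FE [EFe <- <-]]]].
exists (E 0 0), (F 0 0); rewrite -!mx11_scalar; split=> //.
  have mx0 (A B C : 'M[S]_1) : A *m B = C -> A 0 0 * B 0 0 = C 0 0.
    by move=> <-; rewrite mxE big_ord1.
  by split; rewrite (mx0 _ _ _ EE, mx0 _ _ _ FF, mx0 _ _ _ EF, mx0 _ _ _ FE) // mxE.
by have := congr1 (fun A : 'M_1 => A 0 0) EFe; rewrite !mxE eqxx mulr1n.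
Qed.

(** As [a + b] lies below the unit, [a] and [b] come from orthogonal idempotents of [S]. Their
    matched parts give [c], and a central idempotent separates the remainders. *)
Lemma V_comparability a b : Vle (a + b) (Vunit S) ->
  exists c a' b', [/\ a = c + a', b = c + b'
    & forall d, a' + d = b' + d -> a' + d = d /\ b' + d = d].
Proof.
case=> d /esym/(cyc_split (mulr1 1)) [e [_ [[ee _ _ _] _ abE _]]].
have [x [y [oxy _ <- <-]]] := cyc_split ee abE.
have [x1 [x2 [y1 [y2 [ox oy [-> ->] [p [q [pq qp]]] xy2]]]]] :=
  orth_idem_comparability regS csS oxy.
have [g [gg gC x2g gy2]] := central_idem_separation regS csS xy2.
have [x1x1 x2x2 _ _] := ox; have [y1y1 y2y2 _ _] := oy.
have xy1 : cyc x1 = cyc y1.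
  apply/(cls_eqP (scalar_idem x1x1) (scalar_idem y1y1)).
  by exists p%:M, q%:M; rewrite -!scalar_mxM pq qp.
exists (cyc x1), (cyc x2), (cyc y2); split.
- exact: cycD.
- by rewrite xy1; apply: cycD.
move=> d'; have [n [E [EE ->]]] := clsW d' => xy.
have cyc0 : cyc 0 = 0.
  apply/cls_eqP; [by rewrite raddf0 mulmx0 | exact: mul0mx |].
  by exists 0, 0; rewrite !mulmx0 raddf0.
have g'g' : (1 - g) * (1 - g) = 1 - g.
  by rewrite mulrBr mulr1 mulrBl mul1r gg subrr subr0.
have g'C s : (1 - g) * s = s * (1 - g) by rewrite mulrBr mulrBl mulr1 mul1r gC.
(* Cutting by [g] keeps [x2] and removes [y2]; cutting by [1 - g] does the opposite. Each part of
   [d'] thus absorbs one remainder. *)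
have := clsD_cut gg gC (scalar_idem x2x2) EE (scalar_idem y2y2) EE xy.
have := clsD_cut g'g' g'C (scalar_idem x2x2) EE (scalar_idem y2y2) EE xy.
rewrite -!scalar_mxM gy2 gC x2g !mulrBl !mul1r gC x2g gy2 subrr subr0 cyc0 !add0r.
(* [gE] is the equation cut by [1 - g], and [g'E] the one cut by [g]. *)
move=> gE g'E; have EE' := cls_cutD gg gC EE.
rewrite EE'; split; first by rewrite addrA g'E.
by rewrite addrCA -gE.
Qed.

Lemma V_cancel_cyclic a b c : Vle c (Vunit S) -> Vle c a -> Vle c b ->
  a + c = b + c -> a = b.
Proof.
move=> [t ct] [a0 ca] [b0 cb] /(V_refinement regS) [a1 [y [x [z [aE cE bE cE']]]]].
(* Adding [t] completes [c] to the unit. The second refinement removes a common part [p], after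
   which [x0 + y0] fits below the unit, as comparability requires. *)
have : x + (z + t) = y + (z + t) by rewrite !addrA -cE -cE'.
move=> /(V_refinement regS) [p [x0 [y0 [q [xE ztE yE _]]]]].
have : Vle (x0 + y0) (Vunit S).
  by exists (p + q); rewrite -ct cE -(addrA x) ztE xE addrACA (addrC x0).
move=> /V_comparability [k [x' [y' [x0E y0E absorb]]]].
have xE' : x = x' + (p + k) by rewrite xE x0E addrA addrC.
have yE' : y = y' + (p + k) by rewrite yE y0E addrA addrC.
(* With this argument both sides of the hypothesis of [absorb] equal [c]. *)
have [|x'z y'z] := absorb (p + k + z); first by rewrite !(addrA _ (p + k)) -xE' -yE' -cE.
have x'c : x' + c = c by rewrite cE xE' -addrA !x'z.
have y'c : y' + c = c by rewrite cE xE' -addrA x'z y'z.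
have -> : a = x' + a by rewrite -ca addrA x'c.
have -> : b = y' + b by rewrite -cb addrA y'c.
by rewrite aE bE xE' yE' (addrCA a1 y') (addrCA a1 x') (addrCA x' y').
Qed.

Lemma V_cancel_sum a b (s : seq V) :
  (forall c, c \in s -> [/\ Vle c (Vunit S), Vle c a & Vle c b]) ->
  a + \sum_(c <- s) c = b + \sum_(c <- s) c -> a = b.
Proof.
elim: s => [|c s IHs] sP; first by rewrite big_nil !addr0.
have [cu ca cb] := sP c (mem_head c s).
rewrite big_cons addrCA [RHS]addrCA ![c + _]addrC => /V_cancel_cyclic abE.
apply: IHs => [d ds|]; first by apply: sP; rewrite inE ds orbT.
by apply: abE => //; apply: Vle_addr.
Qed.

(** Separativity only bounds summands by [a + a], while cancellation needs them below [a];
    refinement splits each into two such pieces. *)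
Lemma V_sum_halve a (s : seq V) :
  (forall c, c \in s -> Vle c (Vunit S) /\ Vle c (a + a)) ->
  exists2 s' : seq V, \sum_(c <- s) c = \sum_(c <- s') c
    & forall c, c \in s' -> Vle c (Vunit S) /\ Vle c a.
Proof.
elim: s => [|c s IHs] sP; first by exists [::].
have [|s' sE s'P] := IHs; first by move=> d ds; apply: sP; rewrite inE ds orbT.
have [cu /(Vle_add_split regS)[c1 [c2 [cE c1a c2a]]]] := sP c (mem_head c s).
exists [:: c1, c2 & s']; first by rewrite !big_cons sE cE addrA.
move=> d; rewrite !inE => /or3P[/eqP-> | /eqP-> | /s'P//]; split=> //.
- by apply: Vle_trans cu; exists c2.
- by apply: Vle_trans cu; exists c1; rewrite addrC.
Qed.

(** The summands of [b] are cancelled from [a + b = b + b]. They lie below [a + b = a + a], hence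
    below [a] after halving, and below [b] as parts of it. *)
Lemma V_separative a b : a + b = a + a -> a + a = b + b -> a = b.
Proof.
move=> ab aabb; have [s [bE sP]] := V_sum_cyclic regS b.
have Vle_sum (r : seq V) c : c \in r -> Vle c (\sum_(c <- r) c).
  by move=> cr; exists (\sum_(d <- rem c r) d); rewrite [RHS](big_rem _ cr).
have [|s' sE s'P] := @V_sum_halve a s.
  move=> c cs; split; first exact: sP.
  by rewrite -ab addrC; apply: Vle_addr; rewrite bE; apply: Vle_sum.
apply: (@V_cancel_sum a b s'); last by rewrite -sE -bE ab.
move=> c cs; have [cu ca] := s'P _ cs; split=> //.
by rewrite bE sE; apply: Vle_sum.
Qed.

End Cancellation.

(** * Modules presented by idempotent matrices *)

Section Presentations.
Variable S : pzRingType.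
Implicit Types M N : lmodType S.

(** [f] and [h] make [M] a retract of a module of row vectors, so that [M] is the row space of [E]
    up to isomorphism. *)
Definition presents n (E : 'M[S]_n) M : Prop :=
  exists (f : {linear M -> 'rV[S]_n}) (h : {linear 'rV[S]_n -> M}),
    (forall x, h (f x) = x) /\ (forall v, f (h v) = v *m E).

Lemma presents_idem n (E : 'M[S]_n) M : presents E M -> E *m E = E.
Proof.
case=> f [h [hf fh]]; apply/row_matrixP=> i; rewrite row_mul.
by have -> : row i E = f (h (row i 1%:M)); [rewrite fh -row_mul mul1mx | rewrite -fh hf].
Qed.

(** Generators give a surjection [h] from row vectors, which projectivity splits by some [f]; [E] is
    the matrix of [f \o h]. *)
Lemma fg_projective_presented M : finitely_generated M -> projective M ->
  exists n (E : 'M[S]_n), presents E M.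
Proof.
move=> [n [v gen]] proj.
pose h0 (c : 'rV[S]_n) : M := \sum_(i < n) c 0 i *: v i.
have h_lin : linear h0.
  move=> a c d; rewrite /h0 scaler_sumr -big_split; apply: eq_bigr => i _ /=.
  by rewrite !mxE scalerDl scalerA.
pose hL := GRing.isLinear.Build S 'rV[S]_n M *:%R h0 h_lin.
pose h : {linear 'rV[S]_n -> M} := HB.pack h0 hL.
have [|f fK] := proj _ _ h idfun.
  move=> x; have [c ->] := gen x; exists (\row_i c i).
  by apply: eq_bigr => i _; rewrite mxE.
exists n, (lin1_mx (f \o h)), f, h; split=> // u.
by rewrite mul_rV_lin1.
Qed.

Lemma presents_pair m n (E : 'M[S]_m) (F : 'M[S]_n) M N :
  presents E M -> presents F N -> presents (mx_sum E F) (M * N)%type.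
Proof.
move=> [f [h [hf fh]]] [f' [h' [hf' fh']]].
pose p0 (x : M * N) : 'rV[S]_(m + n) := row_mx (f x.1) (f' x.2).
have p_lin : linear p0.
  by move=> a x y; rewrite /p0 /= !linearP scale_row_mx add_row_mx.
pose q0 (v : 'rV[S]_(m + n)) : M * N := (h (lsubmx v), h' (rsubmx v)).
have q_lin : linear q0 by move=> a x y; rewrite /q0 !linearP.
pose pL := GRing.isLinear.Build S (M * N)%type 'rV[S]_(m + n) *:%R p0 p_lin.
pose qL := GRing.isLinear.Build S 'rV[S]_(m + n) (M * N)%type *:%R q0 q_lin.
pose p : {linear (M * N)%type -> 'rV[S]_(m + n)} := HB.pack p0 pL.
pose q : {linear 'rV[S]_(m + n) -> (M * N)%type} := HB.pack q0 qL.
exists p, q; split=> [[x y]|v] /=.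
  by rewrite /q0 /p0 row_mxKl row_mxKr hf hf'.
rewrite /p0 /q0 /= fh fh' -[v in RHS]hsubmxK mul_row_block !mulmx0.
by rewrite addr0 add0r.
Qed.

Lemma presents_isomorphic n (E : 'M[S]_n) M N :
  isomorphic M N -> presents E M -> presents E N.
Proof.
move=> [k [k' kK k'K]] [f [h [hf fh]]].
have k'_lin : linear k'.
  by move=> a x y; apply: (can_inj kK); rewrite linearP !k'K.
pose kL := GRing.isLinear.Build S N M *:%R k' k'_lin.
pose k'' : {linear N -> M} := HB.pack k' kL.
exists (f \o k''), (k \o h); split=> [x|v] /=; first by rewrite hf k'K.
by rewrite kK.
Qed.

Lemma presents_sim m n (E : 'M[S]_m) (F : 'M[S]_n) M :
  presents E M -> presents F M -> sim E F.
Proof.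
move=> [f [h [hf fh]]] [f' [h' [hf' fh']]].
exists (lin1_mx (f' \o h)), (lin1_mx (f \o h')).
split; apply/row_matrixP=> i; rewrite 2!rowE mulmxA !mul_rV_lin1 /=.
- by rewrite hf' fh.
- by rewrite hf fh'.
Qed.

Lemma sim_isomorphic m n (E : 'M[S]_m) (F : 'M[S]_n) M N :
  presents E M -> presents F N -> sim E F -> isomorphic M N.
Proof.
move=> pE pF [X [Y [XY YX]]].
case: pE => f [h [hf fh]]; case: pF => f' [h' [hf' fh']].
exists (h' \o (mulmxr X \o f)); exists (h \o (mulmxr Y \o f')) => x /=.
- rewrite fh' -!mulmxA (mulmxA X) -YX !mulmxA -(mulmxA _ X Y) XY.
  by rewrite -(mulmxA _ X Y) XY -fh -fh !hf.
- rewrite fh -!mulmxA (mulmxA Y) -XY !mulmxA -(mulmxA _ Y X) YX.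
  by rewrite -(mulmxA _ Y X) YX -fh' -fh' !hf'.
Qed.

End Presentations.

Theorem proposition2p10 (R : pzRingType) :
  regular_ring R -> right_CS R -> separative R.
Proof.
move=> regR csR M N fgM pM fgN pN MN MM.
(* The results above apply to [S := R^c], whose left ideals are the right ideals of [R]; regularity
   passes to the converse ring by reassociating. *)
have regS : regular_ring R^c.
  by move=> a; have [b ab] := regR a; exists b; apply: etrans ab (esym (@mulrA R a b a)).
have [m [E pE]] := fg_projective_presented fgM pM.
have [n [F pF]] := fg_projective_presented fgN pN.
have EE := presents_idem pE; have FF := presents_idem pF.
have clsE p q (A : 'M[R^c]_p) (B : 'M[R^c]_q) (P Q : lmodType R^c) :
    presents A P -> presents B Q -> isomorphic P Q -> cls A = cls B.
  move=> pA pB PQ; apply/(cls_eqP (presents_idem pA) (presents_idem pB)).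
  exact: presents_sim (presents_isomorphic PQ pA) pB.
apply: (sim_isomorphic pE pF); apply/(cls_eqP EE FF).
apply: (V_separative regS csR); rewrite -!cls_mx_sum //.
- by apply: clsE MN; apply: presents_pair.
- by apply: clsE MM; apply: presents_pair.
Qed.
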